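(* If $\alpha^*=\alpha+\lambda T$ is a $T$-$P^*$ associated curve of $\alpha$ (with respect to some real constants $c,d$, not both zero), then $\alpha^*$ is an involute of $\alpha$.
   Context: $\alpha$ is a smooth curve in $E^3$ parametrized by arc length $s$, with Frenet frame $\{T,N,B\}$, curvature $\kappa>0$ and torsion $\tau$: $T'=\kappa N$, $N'=-\kappa T+\tau B$, $B'=-\tau N$. For a curve $\alpha^*$ with the same parameter $s$ (regular, not necessarily unit speed, with ${\alpha^*}'\wedge{\alpha^*}''\ne 0$), $T^*={\alpha^*}'/\|{\alpha^*}'\|$, $B^*=({\alpha^*}'\wedge{\alpha^*}'')/\|{\alpha^*}'\wedge{\alpha^*}''\|$, $N^*=B^*\wedge T^*$. For real constants $c,d$ put $P^*=\frac{cN^*+dB^*}{\sqrt{c^2+d^2}}$. The curve $\alpha^*$ is called a $T$-$P^*$ associated curve of $\alpha$ if $\alpha^*=\alpha+\lambda T$ for a smooth real function $\lambda$ of $s$ and $T$ is linearly dependent with $P^*$, normalized so that $T=P^*$. An involute of $\alpha$ is a curve $\alpha^*$ such that each $\alpha^*(s)$ lies on the tangent line of $\alpha$ at $\alpha(s)$ and $\langle T,T^*\rangle=0$. *)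

(* Defs.v *)
From HB Require Import structures.
From mathcomp Require Import all_boot all_order all_algebra.
From mathcomp Require Import all_classical all_reals all_analysis.
Set Implicit Arguments.
Unset Strict Implicit.
Unset Printing Implicit Defensive.
Import Order.TTheory GRing.Theory Num.Theory.
Import numFieldNormedType.Exports.
Local Open Scope ring_scope.
Local Open Scope classical_set_scope.

(* MathComp-Analysis.  E^3 is 'rV[R]_3; the library norm `|u| on row vectors
   is the sup norm, so the Euclidean norm is defined here as [enorm].  Both
   induce the same topology, hence the same derivatives. *)

Section EuclideanSpace.
Context {R : realType}.
Implicit Types u v : 'rV[R]_3.

Definition dot u v : R := \sum_(i < 3) u 0 i * v 0 i.

Definition enorm u : R := Num.sqrt (dot u u).

Definition cross u v : 'rV[R]_3 :=
  \row_(k < 3) [:: u 0 1 * v 0 2 - u 0 2 * v 0 1;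
                   u 0 2 * v 0 0 - u 0 0 * v 0 2;
                   u 0 0 * v 0 1 - u 0 1 * v 0 0]`_k.

End EuclideanSpace.

Section Curves.
Context {R : realType}.
Implicit Types (I : set R) (s : R).
Implicit Types alpha beta T N B : R -> 'rV[R]_3.
Implicit Types kappa tau lambda : R -> R.

(* All curves are total functions on R of which only the restriction to the
   open interval I matters: I being open, derivatives at points of I do not
   depend on the values outside I. *)
Definition open_interval I : Prop := open I /\ is_interval I.

Definition smooth (V : normedModType R) I (f : R -> V) : Prop :=
  forall (n : nat) s, I s -> derivable (derive1n n f) s 1.

Definition regular_curve I beta : Prop :=
  smooth I beta /\ forall s, I s -> derive1 beta s != 0.

Definition biregular_curve I beta : Prop :=
  regular_curve I beta /\
  forall s, I s -> cross (derive1 beta s) (derive1n 2%N beta s) != 0.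

Definition utangent beta s : 'rV[R]_3 :=
  (enorm (derive1 beta s))^-1 *: derive1 beta s.

Definition ubinormal beta s : 'rV[R]_3 :=
  (enorm (cross (derive1 beta s) (derive1n 2%N beta s)))^-1
    *: cross (derive1 beta s) (derive1n 2%N beta s).

Definition unormal beta s : 'rV[R]_3 :=
  cross (ubinormal beta s) (utangent beta s).

Record frenet_curve I alpha T N B kappa tau : Prop := FrenetCurve {
  frenet_smooth : smooth I alpha;
  frenet_arclength : forall s, I s -> enorm (derive1 alpha s) = 1;
  frenet_T : forall s, I s -> T s = derive1 alpha s;
  frenet_N_unit : forall s, I s -> enorm (N s) = 1;
  frenet_TN : forall s, I s -> dot (T s) (N s) = 0;
  frenet_B : forall s, I s -> B s = cross (T s) (N s);
  frenet_kappa_gt0 : forall s, I s -> 0 < kappa s;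
  frenet_dT : forall s, I s -> is_derive s 1 T (kappa s *: N s);
  frenet_dN : forall s, I s ->
    is_derive s 1 N (- kappa s *: T s + tau s *: B s);
  frenet_dB : forall s, I s -> is_derive s 1 B (- tau s *: N s)
}.

Definition Pvec (c d : R) beta s : 'rV[R]_3 :=
  (Num.sqrt (c ^+ 2 + d ^+ 2))^-1
    *: (c *: unormal beta s + d *: ubinormal beta s).

(* T = P* is the normalized form of the linear dependence of T and P*. *)
Definition TP_associated I alpha T lambda (c d : R) beta : Prop :=
  [/\ biregular_curve I beta,
      smooth I lambda,
      forall s, I s -> beta s = alpha s + lambda s *: T s
    & forall s, I s -> T s = Pvec c d beta s].

Definition tangent_line alpha s : set 'rV[R]_3 :=
  [set p | exists t : R, p = alpha s + t *: derive1 alpha s].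

Definition involute I alpha beta : Prop :=
  regular_curve I beta /\
  forall s, I s ->
    tangent_line alpha s (beta s) /\
    dot (utangent alpha s) (utangent beta s) = 0.

End Curves.

(* Main.v *)
(* T = P* is a combination of N* and B*, and both are cross products
   orthogonal to T*. *)
Require Import Defs.
From mathcomp Require Import all_boot all_order all_algebra.
From mathcomp Require Import all_classical all_reals all_analysis.
From mathcomp Require Import ring.
Import Order.TTheory GRing.Theory Num.Theory.
Import numFieldNormedType.Exports.
Local Open Scope ring_scope.
Local Open Scope classical_set_scope.

(** The argument is pointwise algebra; nothing is differentiated and the Frenet equations do not
    enter. The point α + λT lies on the tangent line because T = α'. Since T = P*, it remains to see
    that P* ⟂ T*: N* = B* ∧ T* is orthogonal to its second factor ([dot_crossr]), and B*, a multiple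
    of α*' ∧ α*'', is orthogonal to its first ([dot_crossl]). *)

Section DotCross.
Context {R : realType}.
Implicit Types (a : R) (u v w : 'rV[R]_3).

Lemma dotC u v : dot u v = dot v u.
Proof. by apply: eq_bigr => i _; rewrite mulrC. Qed.

Lemma dotDl u v w : dot (u + v) w = dot u w + dot v w.
Proof. by rewrite -big_split; apply: eq_bigr => i _; rewrite mxE mulrDl. Qed.

Lemma dotZl a u v : dot (a *: u) v = a * dot u v.
Proof. by rewrite /dot mulr_sumr; apply: eq_bigr => i _; rewrite mxE mulrA. Qed.

Lemma dotZr a u v : dot u (a *: v) = a * dot u v.
Proof. by rewrite dotC dotZl dotC. Qed.

Lemma dot_crossl u v : dot (cross u v) u = 0.
Proof.
rewrite /dot 3!big_ord_recl big_ord0 !mxE /=.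
(* The sum expansion indexes entries by lifts, [cross] by numerals; [ring] needs the two
   identified. *)
have -> : lift ord0 ord0 = 1 :> 'I_3 by apply: val_inj.
have -> : lift ord0 (lift ord0 ord0) = 2 :> 'I_3 by apply: val_inj.
have -> : ord0 = 0 :> 'I_3 by apply: val_inj.
ring.
Qed.

Lemma dot_crossr u v : dot (cross u v) v = 0.
Proof.
rewrite /dot 3!big_ord_recl big_ord0 !mxE /=.
have -> : lift ord0 ord0 = 1 :> 'I_3 by apply: val_inj.
have -> : lift ord0 (lift ord0 ord0) = 2 :> 'I_3 by apply: val_inj.
have -> : ord0 = 0 :> 'I_3 by apply: val_inj.
ring.
Qed.

End DotCross.

(** By bilinearity all normalizing scalars factor out, leaving only products of a cross product with
    one of its factors. *)
Lemma dot_Pvec_utangent (R : realType) (c d : R) (beta : R -> 'rV[R]_3) (s : R) :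
  dot (Pvec c d beta s) (utangent beta s) = 0.
Proof.
rewrite dotZl dotDl !dotZl dot_crossr /utangent dotZr dot_crossl.
by rewrite !mulr0 addr0 mulr0.
Qed.

Theorem corollary2p4p1 (R : realType) (I : set R)
  (alpha T N B : R -> 'rV[R]_3) (kappa tau : R -> R)
  (alphastar : R -> 'rV[R]_3) (lambda : R -> R) (c d : R)
  (hI : open_interval I)
  (halpha : frenet_curve I alpha T N B kappa tau)
  (hcd : ~ (c = 0 /\ d = 0))
  (hassoc : TP_associated I alpha T lambda c d alphastar) :
  involute I alpha alphastar.
Proof.
case: hassoc => -[hreg _] _ hstar hTP; split=> // s Is; split.
  by exists (lambda s); rewrite hstar// (frenet_T halpha).
(* Unit speed reduces the normalized tangent of [alpha] to α' = T, which is then replaced by P*. *)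
rewrite {1}/utangent (frenet_arclength halpha)// invr1 scale1r.
by rewrite -(frenet_T halpha)// hTP// dot_Pvec_utangent.
Qed.
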